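(* For any integers $m,n\geq 2$, the category $\mathcal{M}_{\mathfrak{sl}(m|n)}(2)$ is empty; that is, there is no $\mathcal{U}(\mathfrak{sl}(m|n))$-module (not necessarily $\mathbb{Z}_2$-graded) whose restriction to $\mathcal{U}(\mathfrak{h})$ is free of rank 2.
   Context: Everything is over $\mathbb{C}$. $\mathfrak{sl}(m|n)$ is the Lie superalgebra of supertraceless $(m+n)\times(m+n)$ matrices with rows and columns indexed by $\{1,\dots,m\}\cup\{\bar 1,\dots,\bar n\}$; $e_{IJ}$ are the matrix units, with $e_{ij},e_{\bar i\bar j}$ even and $e_{i\bar j},e_{\bar j i}$ odd, and $[x,y]=xy-(-1)^{|x||y|}yx$. The Cartan subalgebra $\mathfrak{h}$ (the diagonal matrices in $\mathfrak{sl}(m|n)$) has basis $h_i=e_{ii}+e_{\bar n\bar n}$ for $1\le i\le m$ and $h_{\bar j}=e_{\bar j\bar j}+e_{mm}$ for $1\le j\le n-1$, and $\mathcal{U}(\mathfrak{h})$ is the polynomial algebra in these elements. $\mathcal{U}(\mathfrak{sl}(m|n))$ is viewed as an ungraded associative algebra, so a module is a vector space on which $[x,y]$ acts as $xy-(-1)^{|x||y|}yx$ for homogeneous $x,y\in\mathfrak{sl}(m|n)$. $\mathcal{M}_{\mathfrak{sl}(m|n)}(2)$ is the category of such modules whose restriction to $\mathcal{U}(\mathfrak{h})$ is free of rank 2. *)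

(* Defs.v *)
From HB Require Import structures.
From mathcomp Require Import all_boot all_order all_algebra.
From mathcomp Require Import ring reals complex ssrcomplements mpoly.

Set Implicit Arguments.
Unset Strict Implicit.
Unset Printing Implicit Defensive.

Import GRing.Theory.
Local Open Scope ring_scope.

Section Superalgebra.
Variables (F : fieldType) (m n : nat).
Implicit Types A B : 'M[F]_(m + n).

(* Rows and columns are indexed by 'I_(m + n), counting from 0: unbarred
   indices are [lshift n i], barred ones are [rshift m j]. *)

Definition str A : F := \tr (ulsubmx A) - \tr (drsubmx A).

(* [spart false A] is the even (block diagonal) part of A, [spart true A] its
   odd (block antidiagonal) part. *)
Definition spart (p : bool) A : 'M[F]_(m + n) :=
  if p then block_mx 0 (ursubmx A) (dlsubmx A) 0
  else block_mx (ulsubmx A) 0 0 (drsubmx A).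

Definition homogeneous (p : bool) A : bool := A == spart p A.

(* Bilinear extension of [x, y] = xy - (-1)^(|x||y|) yx. *)
Definition sbracket A B : 'M[F]_(m + n) :=
  \sum_(p : bool) \sum_(q : bool)
    (spart p A *m spart q B - (-1) ^+ (p && q) *: (spart q B *m spart p A)).

Lemma spart_sum A : A = spart false A + spart true A.
Proof.
by rewrite add_block_mx !addr0 !add0r submxK.
Qed.

Lemma spart_id p q A :
  homogeneous p A -> spart q A = if q == p then A else 0.
Proof.
move=> /eqP {1 2}->; case: p; case: q => /=;
  rewrite /spart ?block_mxEul ?block_mxKul ?block_mxKur ?block_mxKdl
    ?block_mxKdr //; exact: block_mx0.
Qed.

Lemma sbracketE p q A B : homogeneous p A -> homogeneous q B ->
  sbracket A B = A *m B - (-1) ^+ (p && q) *: (B *m A).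
Proof.
move=> hA hB; rewrite /sbracket !big_bool !(spart_id _ hA) !(spart_id _ hB).
by case: p {hA}; case: q {hB} => /=;
  rewrite ?mul0mx ?mulmx0 ?scaler0 ?subr0 ?addr0 ?add0r.
Qed.

Fact str_is_linear : scalar str.
Proof.
by move=> a A B; rewrite /str /ulsubmx /drsubmx !linearP /= mulrBr opprD addrACA.
Qed.
HB.instance Definition _ := GRing.isLinear.Build F _ _ *%R str str_is_linear.

Definition supertraceless : pred 'M[F]_(m + n) := [pred A | str A == 0].

Fact supertraceless_submod : submod_closed supertraceless.
Proof.
split=> [|a A B]; rewrite !inE ?linear0 // => /eqP hA /eqP hB.
by rewrite linearP /= hA hB mulr0 addr0.
Qed.
HB.instance Definition _ := GRing.isSubmodClosed.Build F _ supertraceless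
  supertraceless_submod.

Record sl := Sl { slval :> 'M[F]_(m + n); slvalP : slval \in supertraceless }.
HB.instance Definition _ := [isSub for slval].
HB.instance Definition _ := [Choice of sl by <:].
HB.instance Definition _ := [SubChoice_isSubLmodule of sl by <:].

Fact sbracket_supertraceless A B : sbracket A B \in supertraceless.
Proof.
rewrite inE /sbracket !big_bool /spart /= !mulmx_block !scale_block_mx.
rewrite !opp_block_mx !add_block_mx /str block_mxKul block_mxKdr.
rewrite !expr0 !expr1 !scale1r !scaleN1r !opprK.
rewrite !mul0mx !mulmx0 ?oppr0 ?addr0 ?add0r ?oppr0 ?addr0 ?add0r.
rewrite !raddfD !raddfN /=.
rewrite (mxtrace_mulC (ursubmx A) (dlsubmx B)).
rewrite (mxtrace_mulC (dlsubmx A) (ursubmx B)).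
rewrite (mxtrace_mulC (ulsubmx A) (ulsubmx B)).
rewrite (mxtrace_mulC (drsubmx A) (drsubmx B)).
by apply/eqP; ring.
Qed.

Definition slbracket (x y : sl) : sl := Sl (sbracket_supertraceless x y).

(* A module over U(sl(m|n)), the latter seen as an ungraded associative
   algebra: the carrier is any vector space, with no Z/2-grading. *)
Record slModule := SlModule {
  slcarrier :> lmodType F;
  slact : sl -> slcarrier -> slcarrier;
  slact_linearl : forall v, linear (fun x => slact x v);
  slact_linearr : forall x, linear (slact x);
  slact_bracket : forall (p q : bool) (x y : sl) (v : slcarrier),
    homogeneous p x -> homogeneous q y ->
    slact (slbracket x y) v =
      slact x (slact y v) - (-1) ^+ (p && q) *: slact y (slact x v)
}.

End Superalgebra.

Section PolyAction.
Variables (F : fieldType) (k : nat) (V : lmodType F) (T : 'I_k -> V -> V).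
Implicit Types (p q : {mpoly F[k]}) (v : V).

Definition monact (d : 'X_{1..k}) : V -> V :=
  \big[(fun f g => f \o g)/id]_(i < k) iter (d i) (T i).

(* p(T_0, ..., T_(k-1)) v *)
Definition polyact p v : V := \sum_(d <- msupp p) p@_d *: monact d v.

Hypothesis T_lin : forall i, linear (T i).
Hypothesis T_comm : forall i j v, T i (T j v) = T j (T i v).

Lemma monact_linear d : linear (monact d).
Proof.
rewrite /monact; elim/big_rec: _ => [//|i f _ IH] a u v /=.
by rewrite IH; elim: (d i) => //= e ->; rewrite T_lin.
Qed.

Lemma monact0 v : monact 0%MM v = v.
Proof.
rewrite /monact; elim/big_rec: _ => [//|i f _ IH] /=.
by rewrite mnm0E.
Qed.

Lemma monactD d e v : monact (d + e) v = monact d (monact e v).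
Proof.
have iterC i a j b u : iter a (T i) (iter b (T j) u)
    = iter b (T j) (iter a (T i) u).
  have C1 w : T i (iter b (T j) w) = iter b (T j) (T i w).
    by elim: b => //= b IH; rewrite T_comm IH.
  by elim: a => //= a ->.
rewrite /monact; elim: (index_enum _) v => [|i r IH] v; first by rewrite !big_nil.
rewrite !big_cons /= mnmDE iterD IH; congr (iter _ _ _).
move: (_ v) => w; elim: r {IH} => [|j r IH]; first by rewrite !big_nil.
by rewrite !big_cons /= iterC IH.
Qed.

Lemma polyactX d v : polyact 'X_[d] v = monact d v.
Proof. by rewrite /polyact msuppX big_seq1 mcoeffX eqxx scale1r. Qed.

Lemma monactU i v : monact U_(i) v = T i v.
Proof.
rewrite /monact; have : i \in index_enum 'I_k by rewrite mem_index_enum.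
have : uniq (index_enum 'I_k) by rewrite index_enum_uniq.
have N r : i \notin r ->
    (\big[(fun f g => f \o g)/id]_(j <- r) iter (U_(i)%MM j) (T j)) v = v.
  elim: r => [|j r IH]; first by rewrite big_nil.
  rewrite inE negb_or big_cons mnm1E => /andP[/negPf-> nir] /=.
  exact: IH.
elim: (index_enum _) => [//|j r IH] /= /andP[njr ur].
rewrite inE big_cons mnm1E; case: eqP => /= [ij _|_]; last exact: IH.
by rewrite N ij.
Qed.

Lemma polyact_w N p v : (msize p <= N)%N ->
  polyact p v = \sum_(d : 'X_{1..k < N}) p@_d *: monact d v.
Proof.
move=> leN; set I : subFinType _ := 'X_{1..k < N}.
rewrite /polyact (big_mksub I) ?msupp_uniq //=; first last.
  by move=> d /msize_mdeg_lt /leq_trans; apply.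
rewrite big_rmcond //= => d /memN_msupp_eq0 ->.
by rewrite scale0r.
Qed.

Lemma polyact_linearl v : linear (fun p => polyact p v).
Proof.
move=> a p q.
pose N := maxn (msize (a *: p + q)) (maxn (msize p) (msize q)).
rewrite !(@polyact_w N) ?leq_max ?leqnn ?orbT //.
rewrite scaler_sumr -big_split /=; apply: eq_bigr => d _.
by rewrite mcoeffD mcoeffZ scalerDl scalerA.
Qed.

Lemma polyact_linearr p : linear (polyact p).
Proof.
move=> a u v; rewrite /polyact scaler_sumr -big_split /=.
apply: eq_bigr => d _; rewrite monact_linear scalerDr !scalerA.
by rewrite mulrC.
Qed.

Lemma polyact1 v : polyact 1 v = v.
Proof. by rewrite -mpolyX0 polyactX monact0. Qed.

Let lin_sumZ (U W : lmodType F) (G : U -> W) (linG : linear G) (I : Type)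
    (r : seq I) (c : I -> F) (u : I -> U) :
  G (\sum_(i <- r) c i *: u i) = \sum_(i <- r) c i *: G (u i).
Proof.
have G0 : G 0 = 0.
  by have := linG (-1) 0 0; rewrite scaler0 addr0 scaleN1r addNr.
elim: r => [|i r IH]; first by rewrite !big_nil.
by rewrite !big_cons linG IH.
Qed.

Lemma polyactM p q v : polyact (p * q) v = polyact p (polyact q v).
Proof.
rewrite [in LHS](mpolyE p) mulr_suml.
under eq_bigr => d _ do rewrite -scalerAl.
rewrite (lin_sumZ (polyact_linearl v)) [RHS]/polyact; apply: eq_bigr => d _.
congr (_ *: _); rewrite [in LHS](mpolyE q) mulr_sumr.
under eq_bigr => e _ do rewrite -scalerAr -mpolyXD.
rewrite (lin_sumZ (polyact_linearl v)) [polyact q v]/polyact (lin_sumZ (monact_linear d)).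
apply: eq_bigr => e _; congr (_ *: _).
by rewrite polyactX monactD.
Qed.

End PolyAction.

Section Cartan.
Variables (F : fieldType) (m n : nat) (m_gt0 : (0 < m)%N) (n_gt0 : (0 < n)%N).

Definition last_ord k (k_gt0 : (0 < k)%N) : 'I_k :=
  Ordinal (etrans (ltn_predL k) k_gt0).

Definition eu (i : 'I_(m + n)) : 'M[F]_(m + n) := delta_mx i i.

(* The basis of the Cartan subalgebra: h_i = e_ii + e_(bar n)(bar n) for i < m,
   and h_(bar j) = e_(bar j)(bar j) + e_mm for j < n - 1. *)
Definition cartan_mx (k : 'I_(m + n.-1)) : 'M[F]_(m + n) :=
  match split k with
  | inl i => eu (lshift n i) + eu (rshift m (last_ord n_gt0))
  | inr j => eu (rshift m (widen_ord (leq_pred n) j))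
             + eu (lshift n (last_ord m_gt0))
  end.

Lemma eu_even i : homogeneous false (eu i).
Proof.
rewrite /homogeneous /spart -[X in X == _]submxK; apply/eqP.
congr block_mx; apply/matrixP => a b; rewrite !mxE;
 case: eqP => //= <-; rewrite ?eq_lrshift ?eq_rlshift //.
Qed.

Lemma cartan_even k : homogeneous false (cartan_mx k).
Proof.
have D i j : homogeneous false (eu i + eu j).
  rewrite /homogeneous {1}(eqP (eu_even i)) {1}(eqP (eu_even j)) /spart.
  by rewrite add_block_mx !addr0 /ulsubmx /drsubmx !linearD.
by rewrite /cartan_mx; case: split => ?; apply: D.
Qed.

Lemma str_eul i : str (eu (lshift n i)) = 1.
Proof.
rewrite /str /mxtrace (bigD1 i) //= !mxE !eqxx big1 ?addr0; last first.
  by move=> j ji; rewrite !mxE eq_lshift (negPf ji).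
by rewrite big1 ?subr0 // => j _; rewrite !mxE eq_rlshift.
Qed.

Lemma str_eur j : str (eu (rshift m j)) = -1.
Proof.
rewrite /str /mxtrace big1 ?sub0r; last first.
  by move=> i _; rewrite !mxE eq_lrshift.
rewrite (bigD1 j) //= !mxE !eqxx big1 ?addr0 // => i ij.
by rewrite !mxE eq_rshift (negPf ij).
Qed.

Lemma cartan_supertraceless k : cartan_mx k \in @supertraceless F m n.
Proof.
rewrite inE /cartan_mx; case: split => i; rewrite linearD /= str_eul str_eur.
  by rewrite subrr.
by rewrite addNr.
Qed.

Definition cartan (k : 'I_(m + n.-1)) : sl F m n :=
  Sl (cartan_supertraceless k).

Lemma slbracket_cartan i j : slbracket (cartan i) (cartan j) = 0.
Proof.
apply: val_inj => /=.
rewrite (sbracketE (cartan_even i) (cartan_even j)) /= scale1r.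
have E a b : eu a *m eu b = eu b *m eu a.
  by rewrite !mul_delta_mx_cond eq_sym; case: eqP => [->|].
have D a b c d : (eu a + eu b) *m (eu c + eu d) = (eu c + eu d) *m (eu a + eu b).
  by rewrite !mulmxDl !mulmxDr !(E c) !(E d) addrACA.
by rewrite /cartan_mx; case: split => a; case: split => b; rewrite D subrr.
Qed.

Variable M : slModule F m n.

Lemma slact_cartanC i j (v : M) :
  slact (cartan i) (slact (cartan j) v) = slact (cartan j) (slact (cartan i) v).
Proof.
have act0 : slact 0 v = 0.
  have := slact_linearl v (-1) 0 0.
  by rewrite /= scaler0 addr0 scaleN1r addNr.
have := @slact_bracket _ _ _ M false false (cartan i) (cartan j) v
  (cartan_even i) (cartan_even j).
by rewrite slbracket_cartan act0 /= scale1r => /esym/eqP; rewrite subr_eq0 => /eqP.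
Qed.

End Cartan.

(* The restriction of M to U(h), as a module over {mpoly F[m + n.-1]}: the
   k-th variable is the basis element [cartan k] of h. The alias carries this
   module structure alongside the F-vector space structure of M. *)
Definition resUh (F : fieldType) (m n : nat) (m_gt0 : (0 < m)%N)
  (n_gt0 : (0 < n)%N) (M : slModule F m n) : Type := M.

Section Restriction.
Variables (F : fieldType) (m n : nat) (m_gt0 : (0 < m)%N) (n_gt0 : (0 < n)%N).
Variable M : slModule F m n.

Definition Uhact (p : {mpoly F[m + n.-1]}) (v : M) : M :=
  polyact (fun k => slact (cartan F m_gt0 n_gt0 k) : M -> M) p v.

Let actL k := @slact_linearr F m n M (cartan F m_gt0 n_gt0 k).
Let actC := slact_cartanC m_gt0 n_gt0 (M := M).

HB.instance Definition _ := GRing.Zmodule.copy (resUh m_gt0 n_gt0 M) M.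

Fact UhactA (p q : {mpoly F[m + n.-1]}) (v : M) :
  Uhact p (Uhact q v) = Uhact (p * q) v.
Proof. by rewrite /Uhact (polyactM actL actC). Qed.

Fact Uhact1 : left_id 1 Uhact.
Proof. by move=> v; rewrite /Uhact polyact1. Qed.

Fact UhactDr : right_distributive Uhact +%R.
Proof.
by move=> p u v; have := polyact_linearr actL p 1 u v; rewrite !scale1r.
Qed.

Fact UhactDl (v : M) : {morph Uhact^~ v : p q / p + q}.
Proof.
move=> p q; have := polyact_linearl
  (fun k => slact (cartan F m_gt0 n_gt0 k) : M -> M) v 1 p q.
by rewrite !scale1r.
Qed.

HB.instance Definition _ := GRing.Zmodule_isLmodule.Build
  {mpoly F[m + n.-1]} (resUh m_gt0 n_gt0 M) UhactA Uhact1 UhactDr UhactDl.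

Lemma resUh_scaleX k (v : resUh m_gt0 n_gt0 M) :
  'X_k *: v = slact (cartan F m_gt0 n_gt0 k) (v : M).
Proof. by rewrite -[LHS]/(polyact _ _ _) polyactX monactU. Qed.

Lemma resUh_scaleC (c : F) (v : resUh m_gt0 n_gt0 M) :
  c%:MP *: v = c *: (v : M) :> M.
Proof.
rewrite -[LHS]/(polyact _ _ _) -[c%:MP]mulr1 mul_mpolyC.
have := polyact_linearl (fun k => slact (cartan F m_gt0 n_gt0 k) : M -> M)
  v c 1 0.
by rewrite /= addr0 => ->; rewrite polyact1 /polyact msupp0 big_nil addr0.
Qed.

End Restriction.

Definition free_of_rank (A : pzRingType) (r : nat) (N : lmodType A) : Prop :=
  exists b : 'I_r -> N,
    forall v : N, exists! c : 'rV[A]_r, v = \sum_(i < r) c 0 i *: b i.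
Arguments free_of_rank : clear implicits.

(* Main.v *)
From HB Require Import structures.
Require Import Defs.
From mathcomp Require Import all_boot all_order all_algebra.
From mathcomp Require Import ring reals complex mpoly.

(** Over the domain U(h), each root vector acts semilinearly on a free module
    of rank 2.  If f <> 0 and g are anticommuting semilinear operators with
    g^2 = 0, then ker f is contained in ker g: for w in ker f, g w is again in
    ker f, so w and g w are linearly dependent, and g, being nilpotent, kills
    w.  Take f = e_(1,bar 1).  It anticommutes with both e_(m,bar n) and
    e_(bar n,m), as m, n >= 2, so its nonzero kernel is killed by both; but the
    sum of the two products of these operators is h_m, which acts injectively.
    That f <> 0 and ker f <> 0 follows from f^2 = 0 and from the injectivity of
    f e_(bar 1,1) + e_(bar 1,1) f = e_(1,1) + e_(bar 1,bar 1). *)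

Set Implicit Arguments.
Unset Strict Implicit.
Unset Printing Implicit Defensive.

Import GRing.Theory Num.Theory.
Local Open Scope ring_scope.

(** * Free modules of rank 2 over a domain *)

Section RankTwo.
Variables (P : idomainType) (V : lmodType P).
Hypothesis freeV : free_of_rank P 2 V.

Lemma free2_basis : exists b0 b1 : V,
  (forall v, exists c d, v = c *: b0 + d *: b1) /\
  (forall c d, c *: b0 + d *: b1 = 0 -> c = 0 /\ d = 0).
Proof.
have [b bP] := freeV; exists (b 0), (b 1); split=> [v | c d cd0].
  have [c [-> _]] := bP v; exists (c 0 0), (c 0 1).
  by rewrite big_ord_recl big_ord1; congr (_ + _ *: b _); first congr (c _ _);
    apply: val_inj.
have [e [_ uniq_e]] := bP 0.
have e0 : e = 0 by apply: uniq_e; rewrite big1 // => i _; rewrite mxE scale0r.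
have /rowP ecd : e = \row_i (if i == 0 then c else d).
  apply: uniq_e; rewrite big_ord_recl big_ord1 !mxE /= -[LHS]cd0.
  by congr (_ + _ *: b _); apply: val_inj.
by split; [have := ecd 0 | have := ecd 1]; rewrite e0 !mxE.
Qed.

Lemma free2_torsionfree (a : P) (v : V) : a *: v = 0 -> a = 0 \/ v = 0.
Proof.
have [b0 [b1 [span free]]] := free2_basis.
have [c [d ->]] := span v; rewrite scalerDr !scalerA => /free[/eqP ac0 /eqP ad0].
case: (eqVneq a 0) => [|a0]; [by left | right].
by move: ac0 ad0; rewrite !mulf_eq0 !(negPf a0) => /eqP-> /eqP->;
  rewrite !scale0r addr0.
Qed.

(** The determinant of the coordinates of [u] and [w] decides: if it vanishes the two are dependent,
    and otherwise it serves as [d] by Cramer's rule. *)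
Lemma free2_dep (u w : V) :
  (exists2 ab : P * P, ab != (0, 0) & ab.1 *: u + ab.2 *: w = 0) \/
  (exists2 d : P, d != 0 & forall v, exists a b, d *: v = a *: u + b *: w).
Proof.
have [b0 [b1 [span _]]] := free2_basis.
have [u0 [u1 uE]] := span u; have [w0 [w1 wE]] := span w.
have comb a b c0 c1 : c0 = a * u0 + b * w0 -> c1 = a * u1 + b * w1 ->
    c0 *: b0 + c1 *: b1 = a *: u + b *: w.
  move=> -> ->; rewrite uE wE !scalerDr !scalerA !scalerDl.
  by rewrite addrACA.
have comb0 a b : 0 = a * u0 + b * w0 -> 0 = a * u1 + b * w1 ->
    a *: u + b *: w = 0.
  by move=> e0 e1; rewrite -(comb _ _ _ _ e0 e1) !scale0r addr0.
have [det0|det_neq0] := eqVneq (u0 * w1 - u1 * w0) 0; last first.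
  right; exists (u0 * w1 - u1 * w0) => // v; have [v0 [v1 ->]] := span v.
  exists (v0 * w1 - v1 * w0), (u0 * v1 - u1 * v0).
  by rewrite scalerDr !scalerA; apply: comb; ring.
move: det0 => /subr0_eq det0.
(* With zero determinant, either coordinate supplies a relation, [(w0, - u0)] or [(w1, - u1)],
   unless its pair vanishes. If both pairs vanish, [u = w = 0] and [(1, 0)] works. *)
left; have [uw0|uw0] := eqVneq (w0, u0) (0, 0); last first.
  exists (w0, - u0) => /=; last by apply: comb0; ring: det0.
  by move: uw0; rewrite !xpair_eqE oppr_eq0.
have [uw1|uw1] := eqVneq (w1, u1) (0, 0); last first.
  exists (w1, - u1) => /=; last by apply: comb0; ring: det0.
  by move: uw1; rewrite !xpair_eqE oppr_eq0.
case: uw0 uw1 => w00 u00 [w10 u10].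
exists (1, 0); first by rewrite xpair_eqE oner_eq0.
by apply: comb0; rewrite ?u00 ?w00 ?u10 ?w10; ring.
Qed.

End RankTwo.

(** * Kernels of anticommuting semilinear operators *)

Section Anticommuting.
Variables (P : idomainType) (V : lmodType P) (s t : {rmorphism P -> P}).
Variables (f : {linear V -> V | s \; *:%R}) (g : {linear V -> V | t \; *:%R}).
Hypotheses (freeV : free_of_rank P 2 V).
Hypotheses (s_inj : injective s) (t_inj : injective t).
Hypotheses (gg : forall v, g (g v) = 0) (fg : forall v, f (g v) + g (f v) = 0).

Lemma anticomm_ker : (exists v, f v <> 0) -> forall w, f w = 0 -> g w = 0.
Proof.
move=> [v fv] w fw.
have fgw : f (g w) = 0 by have := fg w; rewrite fw linear0 addr0.
have [[[a b] /= ab0 dep] | [d d0 /(_ v)[a [b dv]]]] := free2_dep freeV w (g w).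
  have [a0|a0] := eqVneq a 0.
    move: dep ab0; rewrite a0 scale0r add0r xpair_eqE eqxx /= => dep b0.
    by have [/eqP|//] := free2_torsionfree freeV dep; rewrite (negPf b0).
  (* Applying [g] to [a w + b g w = 0] leaves [t a *: g w = 0], with [t a] nonzero since [t] is
     injective. *)
  have := congr1 g dep; rewrite linearD !linearZ /= gg scaler0 addr0 linear0.
  move=> /(free2_torsionfree freeV)[|//] /eqP.
  by rewrite -(rmorph0 t) (inj_eq t_inj) (negPf a0).
(* If [w] and [g w] spanned up to torsion, [f] would kill [d *: v], so [s d *: f v = 0], against
   [f v <> 0]. *)
have := congr1 f dv; rewrite linearD !linearZ /= fw fgw !scaler0 addr0.
move=> /(free2_torsionfree freeV)[/eqP|//].
by rewrite -(rmorph0 s) (inj_eq s_inj) (negPf d0).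
Qed.

End Anticommuting.

(** * Translations of the polynomial algebra *)

Section Shift.
Variables (F : fieldType) (k : nat).
Implicit Types (c : 'I_k -> F) (p : {mpoly F[k]}).

(** The twist by which a root vector is semilinear over U(h); [c] will list the values of its root
    on the basis of h. *)
Definition mpshift c : {mpoly F[k]} -> {mpoly F[k]} :=
  comp_mpoly [tuple 'X_i - (c i)%:MP | i < k].
HB.instance Definition _ c := GRing.RMorphism.on (mpshift c).

Lemma mpshiftX c i : mpshift c 'X_i = 'X_i - (c i)%:MP.
Proof. by rewrite /mpshift comp_mpolyXU -tnth_nth tnth_mktuple. Qed.

Lemma mpshiftZ c a p : mpshift c (a *: p) = a *: mpshift c p.
Proof. exact: comp_mpolyZ. Qed.

Lemma mpshiftK c : cancel (mpshift c) (mpshift (fun i => - c i)).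
Proof.
move=> p; elim/mpolyind: p => [|a d p _ _ IH]; first by rewrite !rmorph0.
rewrite !rmorphD /= IH; congr (_ + _); rewrite !mpshiftZ; congr (_ *: _).
rewrite mpolyXE_id !rmorph_prod; apply: eq_bigr => i _ /=.
rewrite !rmorphXn /= mpshiftX rmorphB /= mpshiftX /mpshift comp_mpolyC.
by rewrite rmorphN opprK addrK.
Qed.

End Shift.

(** * Odd root vectors, their brackets and their weights *)

Section OddRoots.
Variables (F : fieldType) (m n : nat).
Implicit Types (i : 'I_m) (j : 'I_n).

Lemma str_delta_mx (I J : 'I_(m + n)) : I != J ->
  delta_mx I J \in @supertraceless F m n.
Proof.
move=> IJ; have D K : (K == I) && (K == J) = false.
  by apply: contra_neqF IJ => /andP[/eqP<- /eqP].
by rewrite inE /str /mxtrace !big1 ?subr0 // => k _; rewrite !mxE D.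
Qed.

Lemma lshift_neq_rshift i j : lshift n i != rshift m j.
Proof. by rewrite eq_lrshift. Qed.

Lemma rshift_neq_lshift i j : rshift m j != lshift n i.
Proof. by rewrite eq_rlshift. Qed.

Definition e_ur i j : sl F m n := Sl (str_delta_mx (lshift_neq_rshift i j)).
Definition e_dl j i : sl F m n := Sl (str_delta_mx (rshift_neq_lshift i j)).

Lemma homogeneous_ur i j : homogeneous true (e_ur i j).
Proof.
rewrite /homogeneous /=.
have -> : delta_mx (lshift n i) (rshift m j) =
    block_mx 0 (delta_mx i j) 0 0 :> 'M[F]_(m + n).
  by rewrite delta_mx_ushift delta_mx_rshift /block_mx row_mx0.
by rewrite block_mxKur block_mxKdl.
Qed.

Lemma homogeneous_dl j i : homogeneous true (e_dl j i).
Proof.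
rewrite /homogeneous /=.
have -> : delta_mx (rshift m j) (lshift n i) =
    block_mx 0 0 (delta_mx j i) 0 :> 'M[F]_(m + n).
  by rewrite delta_mx_dshift delta_mx_lshift /block_mx row_mx0.
by rewrite block_mxKur block_mxKdl.
Qed.

Lemma slbracket_urur i j i' j' : slbracket (e_ur i j) (e_ur i' j') = 0.
Proof.
apply: val_inj.
rewrite /= (sbracketE (homogeneous_ur i j) (homogeneous_ur i' j')).
by rewrite /= !mul_delta_mx_cond !eq_rlshift !mulr0n scaler0 subr0.
Qed.

Lemma slbracket_dldl j i j' i' : slbracket (e_dl j i) (e_dl j' i') = 0.
Proof.
apply: val_inj.
rewrite /= (sbracketE (homogeneous_dl j i) (homogeneous_dl j' i')).
by rewrite /= !mul_delta_mx_cond !eq_lrshift !mulr0n scaler0 subr0.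
Qed.

Lemma slbracket_urdl i j j' i' : val (slbracket (e_ur i j) (e_dl j' i')) =
  delta_mx (lshift n i) (lshift n i') *+ (j == j') +
  delta_mx (rshift m j') (rshift m j) *+ (i' == i).
Proof.
rewrite /= (sbracketE (homogeneous_ur i j) (homogeneous_dl j' i')).
by rewrite /= !mul_delta_mx_cond !eq_rshift !eq_lshift scaleN1r opprK.
Qed.

Variables (m_gt0 : (0 < m)%N) (n_gt0 : (0 < n)%N).

Lemma cartan_eigen (u : sl F m n) p I J :
    val u = delta_mx I J -> homogeneous p u ->
  exists c : 'I_(m + n.-1) -> F,
    forall k, slbracket (cartan F m_gt0 n_gt0 k) u = c k *: u.
Proof.
move=> uE hu.
(* The weight of e_IJ under the commutator with e_KK; each Cartan basis element is a sum of two such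
   e_KK, so its eigenvalue is a sum of two weights. *)
pose w (K : 'I_(m + n)) : F := (K == I)%:R - (J == K)%:R.
have euE K : eu F K *m delta_mx I J - delta_mx I J *m eu F K
    = w K *: delta_mx I J.
  rewrite !mul_delta_mx_cond scalerBl !scaler_nat.
  by congr (_ - _); case: eqP => // ->.
have D K L : (eu F K + eu F L) *m delta_mx I J
    - delta_mx I J *m (eu F K + eu F L) = (w K + w L) *: delta_mx I J.
  by rewrite mulmxDl mulmxDr scalerDl -!euE opprD addrACA.
pose c k := match split k with
  | inl i => w (lshift n i) + w (rshift m (last_ord n_gt0))
  | inr j => w (rshift m (widen_ord (leq_pred n) j))
             + w (lshift n (last_ord m_gt0))
  end.
exists c => k; apply: val_inj.
rewrite linearZ /= (sbracketE (cartan_even _ _ _ k) hu) scale1r uE.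
by rewrite /c /cartan_mx; case: (split k) => a; apply: D.
Qed.

End OddRoots.

(** * Action of root vectors on the restriction to U(h) *)

Section OddAction.
Variables (F : fieldType) (m n : nat) (m_gt0 : (0 < m)%N) (n_gt0 : (0 < n)%N).
Variable M : slModule F m n.
Notation N := (resUh m_gt0 n_gt0 M).

Lemma slactDl (u w : sl F m n) (v : M) :
  slact (u + w) v = slact u v + slact w v.
Proof. by have := slact_linearl v 1 u w; rewrite /= !scale1r. Qed.

Lemma slactDr (u : sl F m n) (v w : M) :
  slact u (v + w) = slact u v + slact u w.
Proof. by have := slact_linearr u 1 v w; rewrite !scale1r. Qed.

Lemma slact0l (v : M) : slact 0 v = 0.
Proof.
by have := slactDl 0 0 v; rewrite addr0 -{1}[slact 0 v]addr0 => /addrI.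
Qed.

Lemma slact0r (u : sl F m n) : slact u (0 : M) = 0.
Proof.
by have := slactDr u 0 0; rewrite addr0 -{1}[slact u 0]addr0 => /addrI.
Qed.

Lemma slactZl a (u : sl F m n) (v : M) : slact (a *: u) v = a *: slact u v.
Proof. by have := slact_linearl v a u 0; rewrite /= slact0l !addr0. Qed.

Lemma slactZr a (u : sl F m n) (v : M) : slact u (a *: v) = a *: slact u v.
Proof. by have := slact_linearr u a v 0; rewrite slact0r !addr0. Qed.

Lemma slact_odd (u w : sl F m n) (v : M) :
    homogeneous true u -> homogeneous true w ->
  slact (slbracket u w) v = slact u (slact w v) + slact w (slact u v).
Proof. by move=> hu hw; rewrite (slact_bracket v hu hw) scaleN1r opprK. Qed.

Lemma slact_odd_anticomm (u w : sl F m n) (v : M) :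
    homogeneous true u -> homogeneous true w -> slbracket u w = 0 ->
  slact u (slact w v) + slact w (slact u v) = 0.
Proof. by move=> hu hw uw; rewrite -slact_odd // uw slact0l. Qed.

(** For odd [u] the superbracket of [u] with itself acts as twice the square of [u]. *)
Lemma slact_odd_sq (u : sl F m n) (v : M) : 2%:R != 0 :> F ->
    homogeneous true u -> slbracket u u = 0 ->
  slact u (slact u v) = 0.
Proof.
move=> F2 hu uu0; have /eqP := slact_odd_anticomm v hu hu uu0.
by rewrite -mulr2n -scaler_nat scaler_eq0 (negPf F2) => /eqP.
Qed.

(** From [[h_k, u] = c k *: u], moving [u] past [h_k] replaces ['X_k] by ['X_k - c k]; this extends
    to all polynomials, and the twist is invertible by the opposite translation. *)
Lemma slact_semilinear (u : sl F m n) p I J :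
    val u = delta_mx I J -> homogeneous p u ->
  exists s : {rmorphism {mpoly F[m + n.-1]} -> {mpoly F[m + n.-1]}},
    injective s /\
    exists f : {linear N -> N | s \; *:%R}, forall v : N, f v = slact u v.
Proof.
move=> uE hu; have [c cE] := cartan_eigen m_gt0 n_gt0 uE hu.
pose f : N -> N := slact u.
have fX k (v : N) : f ('X_k *: v) = mpshift c 'X_k *: f v.
  have := slact_bracket (x := cartan F m_gt0 n_gt0 k) v
    (cartan_even _ _ _ k) hu.
  rewrite cE slactZl scale1r mpshiftX scalerBl resUh_scaleX resUh_scaleC => E.
  by rewrite [c k *: _]E resUh_scaleX; apply/esym/subKr.
have fXn k e (v : N) : f ('X_k ^+ e *: v) = mpshift c 'X_k ^+ e *: f v.
  elim: e => [|e IH]; first by rewrite !expr0 !scale1r.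
  by rewrite !exprS -!scalerA fX IH.
have fZ q (v : N) : f (q *: v) = mpshift c q *: f v.
  elim/mpolyind: q => [|a d q _ _ IH].
    by rewrite rmorph0 !scale0r; apply: slact0r.
  rewrite rmorphD /= !scalerDl [LHS]slactDr -/f IH; congr (_ + _).
  (* Constants act through the [F]-structure, so they commute with [u]; the monomial is then passed
     one variable at a time. *)
  rewrite mpshiftZ -!mul_mpolyC -!scalerA !resUh_scaleC [LHS]slactZr -/f.
  congr (@GRing.scale F M a _); rewrite mpolyXE_id rmorph_prod /=.
  elim: (index_enum _) => [|k r IHr]; first by rewrite !big_nil !scale1r.
  by rewrite !big_cons -!scalerA fXn rmorphXn IHr.
exists (mpshift c); split; first exact: can_inj (mpshiftK c).
have fL : linear_for (mpshift c \; *:%R) f.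
  by move=> a v w; rewrite [LHS]slactDr -/f fZ.
pose fl : {linear N -> N | mpshift c \; *:%R} :=
  HB.pack f (GRing.isLinear.Build _ _ _ _ f fL).
by exists fl.
Qed.

End OddAction.

(** * The contradiction in rank 2 *)

Theorem theorem5p3 (R : realType) (m n : nat) (hm : (2 <= m)%N) (hn : (2 <= n)%N)
    (M : slModule R[i] m n) :
  ~ free_of_rank {mpoly R[i][m + n.-1]} 2 (resUh (ltnW hm) (ltnW hn) M).
Proof.
set N := resUh _ _ _ => freeN.
pose m_gt0 := ltnW hm; pose n_gt0 := ltnW hn.
pose i0 : 'I_m := Ordinal m_gt0; pose j0 : 'I_n := Ordinal n_gt0.
pose i1 := last_ord m_gt0; pose j1 := last_ord n_gt0.
have i01 : i0 != i1 by rewrite -val_eqE /= neq_ltn ltn_predRL hm.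
have j01 : j0 != j1 by rewrite -val_eqE /= neq_ltn ltn_predRL hn.
pose x := e_ur R[i] i0 j0; pose x' := e_dl R[i] j0 i0.
pose z := e_ur R[i] i1 j1; pose y := e_dl R[i] j1 i1.
have F2 : 2%:R != 0 :> R[i] by rewrite pnatr_eq0.
have hx := homogeneous_ur R[i] i0 j0; have hx' := homogeneous_dl R[i] j0 i0.
have hz := homogeneous_ur R[i] i1 j1; have hy := homogeneous_dl R[i] j1 i1.
pose k0 : 'I_(m + n.-1) := lshift n.-1 i0.
pose k1 : 'I_(m + n.-1) := lshift n.-1 i1.
have n1_gt0 : (0 < n.-1)%N by rewrite ltn_predRL.
(* The index of [h_(bar 1)], which is in the basis because [n >= 2]. *)
pose l0 : 'I_(m + n.-1) := rshift m (Ordinal n1_gt0).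
pose h := cartan R[i] m_gt0 n_gt0.
have zyE : slbracket z y = h k1.
  apply: val_inj; rewrite slbracket_urdl !eqxx !mulr1n /= /cartan_mx.
  by rewrite (unsplitK (inl i1)).
(* e_(1,1) + e_(bar 1,bar 1) in the basis of h: subtracting [h_m] cancels the e_(m,m) and e_(bar
   n,bar n) terms of [h_1 + h_(bar 1)]. *)
have xxE : slbracket x x' = h k0 + h l0 - h k1.
  apply: val_inj; rewrite slbracket_urdl !eqxx !mulr1n linearB linearD /=.
  rewrite /cartan_mx.
  rewrite (unsplitK (inl i0)) (unsplitK (inl i1)) (unsplitK (inr _)).
  have -> : widen_ord (leq_pred n) (Ordinal n1_gt0) = j0 by apply: val_inj.
  rewrite -!/(eu R[i] _) -/i1 -/j1.
  by rewrite [X in X - _]addrACA [X in _ + X - _]addrC addrK.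
have [b0 [b1 [span free]]] := free2_basis freeN.
have b0_neq0 : b0 != 0.
  apply/eqP => b00; have [] := free 1 0;
    first by rewrite b00 scaler0 scale0r addr0.
  by move/eqP; rewrite oner_eq0.
have p_neq0 : 'X_k0 + 'X_l0 - 'X_k1 != 0 :> {mpoly R[i][m + n.-1]}.
  (* Evaluation at the point with ['X_k0 = 1] and all other variables 0 gives 1, as [k0 != k1]. *)
  apply/eqP => /(congr1 (fun p => p.@[fun k => (k == k0)%:R])).
  rewrite mevalB mevalD !mevalXU meval0 eqxx eq_rlshift eq_lshift.
  rewrite eq_sym (negPf i01) addr0 subr0 => /eqP.
  by rewrite oner_eq0.
have pE (v : N) : slact x (slact x' v) + slact x' (slact x v)
    = ('X_k0 + 'X_l0 - 'X_k1) *: v.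
  rewrite -slact_odd // xxE slactDl -scaleN1r slactZl slactDl scaleN1r.
  by rewrite scalerBl scalerDl !resUh_scaleX.
have x_neq0 : exists v : N, slact x v <> 0.
  have [xb0|/eqP] := eqVneq (slact x (b0 : M)) 0; last by exists b0.
  (* If [x] kills [b0], then [x x' b0] is a nonzero polynomial times [b0]. *)
  exists (slact x' b0) => xx'b0; have := pE b0.
  rewrite xb0 xx'b0 slact0r addr0 => /esym /(free2_torsionfree freeN)[|] /eqP.
    by rewrite (negPf p_neq0).
  by rewrite (negPf b0_neq0).
have [s [s_inj [f fE]]] := slact_semilinear m_gt0 n_gt0 M (erefl (val x)) hx.
have ker_x (u : sl R[i] m n) I J (v : N) :
    val u = delta_mx I J -> homogeneous true u ->
    slbracket x u = 0 -> slbracket u u = 0 -> slact x v = 0 -> slact u v = 0.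
  move=> uE hu xu uu xv.
  have [t [t_inj [g gE]]] := slact_semilinear m_gt0 n_gt0 M uE hu.
  rewrite -gE; apply: (anticomm_ker (f := f) freeN s_inj t_inj); rewrite ?fE //.
  - by move=> w; rewrite !gE; apply: slact_odd_sq.
  - by move=> w; rewrite !fE !gE; apply: slact_odd_anticomm.
  - by have [w xw] := x_neq0; exists w; rewrite fE.
(* The nonzero kernel element is [x v], as [x] squares to 0; it remains to derive [x v = 0]. *)
have [v xv] := x_neq0; apply: (xv).
have xxv : slact x (slact x v) = 0.
  by apply: slact_odd_sq => //; apply: slbracket_urur.
have zxv : slact z (slact x v) = 0.
  by apply: (ker_x z _ _ _ (erefl _)) => //; apply: slbracket_urur.
have yxv : slact y (slact x v) = 0.
  apply: (ker_x y _ _ _ (erefl _)) => //; last exact: slbracket_dldl.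
  (* The two terms of this bracket vanish by [j0 != j1] and [i0 != i1] respectively. *)
  apply: val_inj; rewrite slbracket_urdl (negPf j01) eq_sym (negPf i01).
  by rewrite !mulr0n addr0.
have := slact_odd (slact x v) hz hy; rewrite zyE zxv yxv !slact0r addr0.
(* Now [h_m], acting as the nonzero scalar ['X_k1], kills [x v]. *)
rewrite -resUh_scaleX => /(free2_torsionfree freeN)[] // /eqP.
by rewrite -msupp_eq0 msuppX.
Qed.
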